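(* Let $X$ be a separable metric space, $\mu$ a Borel probability measure on $X$ and $T:X\to X$ a measurable map preserving $\mu$. Suppose $(X,T,\mu)$ has decay of correlations given by a function $\Phi:\mathbb{N}\to[0,\infty)$. Let $x_0\in X$ and let $B(x_0,r_i)$, $i\ge 0$, be a sequence of balls centered at $x_0$ with (strictly) decreasing radii $r_i>0$ such that (i) $\displaystyle\liminf_{k\to\infty}\frac{\log\left(\sum_{i=0}^{k}\mu(B(x_0,r_i))\right)}{\log k}=z>0$; (ii) $\displaystyle\liminf_{n\to\infty}\frac{\log(r_{n-1}-r_n)}{\log n}=c\in\mathbb{R}$; (iii) $\displaystyle\sum_{n\ge 1} n^{2-2c+\epsilon}\,\frac{\Phi(\lfloor n^{\alpha}\rfloor)}{\left(\sum_{i=0}^{n}\mu(B(x_0,r_i))\right)^2}<\infty$ for some $0<\alpha<\frac{z}{2}$ and some $\epsilon>0$. Then the sequence $B(x_0,r_i)$ is a strongly Borel-Cantelli (SBC) sequence.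
   Context: $B(x_0,r)$ denotes the ball with center $x_0$ and radius $r$. Decay of correlations given by $\Phi$: for all Lipschitz observables $\phi,\psi:X\to\mathbb{R}$ (of finite Lipschitz norm) and all $n\ge 1$, $$\left|\int \phi\circ T^n\,\psi\,d\mu-\int\phi\,d\mu\int\psi\,d\mu\right|\le \|\phi\|\,\|\psi\|\,\Phi(n),$$ where $\|\phi\|=\sup|\phi|+\mathrm{Lip}(\phi)$ is the Lipschitz norm, $\mathrm{Lip}(\phi)$ being the least Lipschitz constant. No superpolynomial decay of $\Phi$ is assumed here. Strongly Borel-Cantelli (SBC) sequence: a sequence of subsets $S_n\subset X$ is SBC if $\sum_n\mu(S_n)=\infty$ and, for $\mu$-a.e. $x\in X$, $$\frac{\sum_{n=1}^{N}1_{T^{-n}S_n}(x)}{\sum_{n=1}^{N}\mu(S_n)}\to 1\quad\text{as }N\to\infty,$$ where $1_S$ is the indicator function of $S$ and $T^{-n}S_n$ is the preimage of $S_n$ under $T^n$. *)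

(* Defs.v *)
From HB Require Import structures.
From mathcomp Require Import all_boot all_order all_algebra.
From mathcomp Require Import all_classical all_reals all_analysis.

Set Implicit Arguments.
Unset Strict Implicit.
Unset Printing Implicit Defensive.

Import Order.TTheory GRing.Theory Num.Theory.
Import numFieldNormedType.Exports.

Local Open Scope classical_set_scope.
Local Open Scope ring_scope.

(* No compatibility between the two structures is built in: that the
   sigma-algebra is the Borel one is stated separately, by [borel]. *)
#[short(type="measurableMetricType")]
HB.structure Definition MeasurableMetric (d : measure_display)
  (K : numDomainType) := {X of Measurable d X & Metric K X}.

Definition borel {d : measure_display} {R : realType}
    (X : measurableMetricType d R) : Prop :=
  (measurable : set (set X)) = <<s (open : set (set X)) >>.

Definition separable (X : topologicalType) : Prop :=
  exists2 D : set X, countable D & dense D.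

Section lipschitz_norm.
Context {R : realType} {X : metricType R}.
Implicit Type phi : X -> R.
Local Open Scope ereal_scope.

(* [+oo] if [phi] is not Lipschitz; otherwise the infimum is attained. *)
Definition lipschitz_constant phi : \bar R :=
  ereal_inf [set L%:E | L in
    [set L : R | (0 <= L)%R /\
      forall x y : X, (`|phi x - phi y| <= L * mdist x y)%R]].

Definition lipschitz_norm phi : \bar R :=
  ereal_sup [set `|phi x|%:E | x in [set: X]] + lipschitz_constant phi.

End lipschitz_norm.

Section dynamics.
Context {d : measure_display} {R : realType}.

Definition measure_preserving {X : measurableType d}
    (mu : {measure set X -> \bar R}) (T : X -> X) : Prop :=
  measurable_fun [set: X] T /\
  forall A : set X, measurable A -> mu (T @^-1` A) = mu A.

Definition decay_of_correlations {X : measurableMetricType d R}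
    (mu : probability X R) (T : X -> X) (Phi : nat -> R) : Prop :=
  forall phi psi : X -> R,
    (lipschitz_norm phi < +oo)%E -> (lipschitz_norm psi < +oo)%E ->
  forall n : nat, (1 <= n)%N ->
    (`| \int[mu]_x (phi (iter n T x) * psi x)
        - (\int[mu]_x phi x) * (\int[mu]_x psi x) |%:E
     <= lipschitz_norm phi * lipschitz_norm psi * (Phi n)%:E)%E.

Definition strongly_borel_cantelli {X : measurableType d}
    (mu : probability X R) (T : X -> X) (S : (set X)^nat) : Prop :=
  (\sum_(1 <= n <oo) mu (S n) = +oo)%E /\
  {ae mu, forall x,
    (\sum_(1 <= n < N.+1) \1_(iter n T @^-1` S n) x)
      / (\sum_(1 <= n < N.+1) fine (mu (S n))) @[N --> \oo] --> (1 : R)}.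

(* The inclusive sum over [0 <= i <= k]. *)
Definition ball_mass {X : measurableMetricType d R} (mu : probability X R)
    (x0 : X) (r : nat -> R) (k : nat) : R :=
  \sum_(0 <= i < k.+1) fine (mu (ball x0 (r i))).

End dynamics.

(* Main.v *)
Require Import Defs.
From HB Require Import structures.
From mathcomp Require Import all_boot all_order all_algebra.
From mathcomp Require Import all_classical all_reals all_analysis.
From mathcomp Require Import measurable_realfun ring lra.

Set Implicit Arguments.
Unset Strict Implicit.
Unset Printing Implicit Defensive.

Import Order.TTheory GRing.Theory Num.Theory.
Import numFieldNormedType.Exports.

Local Open Scope classical_set_scope.
Local Open Scope ring_scope.

(* The indicators of the balls are sandwiched between Lipschitz ramps [f_k]
   equal to 1 on B(x0, r_k) and to 0 outside B(x0, r_(k-1)), whose norms are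
   O(k^(- c + eps/2)) by (ii).  Write M_N for the mass of the first N + 1 balls,
   S_N for the sum of the f_k o T^k and m_N for its mean, so that m_N and M_N
   differ by at most 2.

   In the variance of S_N, a pair (i, j) with |i - j| <= N^alpha contributes at
   most the mean of f_j, for a total of O(N^alpha M_N).  For the other pairs,
   Phi need not be monotone, but each single term of (iii) is bounded, and
   q = |i - j| is the integer part of n^alpha for some n > N.  Since the
   averages M_n / (n + 1) decrease, this yields
     Phi(q) = O(M_N^2 N^(-2) N^(2 alpha + 2c - eps) q^(-2)),
   using c <= -1 (the radii are bounded) and 2 alpha <= 1 (as M_n <= n + 1).
   Altogether the variance is O(N^(2 alpha) M_N), which is O(m_N^s) for some
   s < 2 because M_N dominates a power of N with exponent above 2 alpha.

   Along times where m_N grows polynomially with a large enough degree, the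
   variances of S_N / m_N are summable, so S_N / m_N tends to 1 almost
   everywhere; monotonicity of S_N and m_N fills the gaps. *)

(** * Inverse squares and sums over pairs of indices *)

(** The correction [- n.+1%:R^-1] lets the induction close, since
    [1 / (x + 1) ^ 2 <= 1 / x - 1 / (x + 1)]. *)
Lemma sum_inv_sqr_le (R : realFieldType) n :
  \sum_(1 <= m < n.+2) (m%:R ^+ 2)^-1 <= 2 - n.+1%:R^-1 :> R.
Proof.
elim: n => [|n ih].
  by rewrite big_nat1 expr1n !invr1; lra.
rewrite big_nat_recr//=; apply: (le_trans (lerD ih (lexx _))).
have n1 : 0 < n.+1%:R :> R by rewrite ltr0n.
rewrite -(natr1 n.+1); move: (n.+1%:R) n1 => x x0.
rewrite -subr_ge0.
have -> : 2 - (x + 1)^-1 - (2 - x^-1 + ((x + 1) ^+ 2)^-1) =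
  (x * (x + 1) ^+ 2)^-1 by field; lra.
by rewrite invr_ge0 mulr_ge0 ?exprn_ge0//; lra.
Qed.

Lemma sum_inv_sqr_le2 (R : realFieldType) n :
  \sum_(1 <= m < n.+1) (m%:R ^+ 2)^-1 <= 2 :> R.
Proof.
case: n => [|n]; first by rewrite big_geq.
apply: (le_trans (sum_inv_sqr_le R n)).
by rewrite gerBl invr_ge0.
Qed.

Lemma sum_nat_subnl (R : nmodType) (F : nat -> R) N :
  \sum_(1 <= i < N.+1) F (N.+1 - i)%N = \sum_(1 <= i < N.+1) F i.
Proof.
rewrite big_nat_rev/= !big_nat; apply: eq_bigr => i /andP[i1 iN].
by rewrite add1n subSS subKn// ltnW.
Qed.

(** By induction on [N]: the new row and column contribute twice a row sum plus a diagonal entry. At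
    most [t] entries of the row are near the diagonal, and the inverse squares of the distances to
    it sum to at most 2. *)
Lemma sum_near_diagonal (R : realFieldType) (c : nat -> nat -> R)
    (a : nat -> R) (t : nat) (D : R) (N : nat) :
  (forall i j, c i j = c j i) -> (forall i, 0 <= a i) -> 0 <= D ->
  (forall i j, (1 <= i)%N -> (i <= j <= N)%N ->
    c i j <= (if (j - i <= t)%N then a j else 0) + D / (j - i)%:R ^+ 2) ->
  \sum_(1 <= i < N.+1) \sum_(1 <= j < N.+1) c i j <=
  (2 * t%:R + 1) * \sum_(1 <= j < N.+1) a j + 4 * D * N%:R.
Proof.
move=> csym a0 D0; elim: N => [|N ih] cb.
  by rewrite !big_geq// !mulr0 addr0.
have {}ih : \sum_(1 <= i < N.+1) \sum_(1 <= j < N.+1) c i j <=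
    (2 * t%:R + 1) * \sum_(1 <= j < N.+1) a j + 4 * D * N%:R.
  by apply: ih => i j i1 /andP[ij jN]; apply: cb; rewrite // ij ltnW.
rewrite (big_nat_recr N.+1)//=.
under eq_bigr do rewrite (big_nat_recr N.+1)//=.
rewrite big_split/= !(big_nat_recr N.+1)//=.
have -> : \sum_(1 <= i < N.+1) c N.+1 i = \sum_(1 <= i < N.+1) c i N.+1.
  by apply: eq_bigr.
(* At distance 0 the quotient by [0 ^ 2] is 0, so only [a N.+1] remains. *)
have cNN : c N.+1 N.+1 <= a N.+1.
  have := cb N.+1 N.+1 isT; rewrite leqnn subnn expr0n invr0 mulr0 addr0.
  exact.
have row : \sum_(1 <= i < N.+1) c i N.+1 <= t%:R * a N.+1 + 2 * D.
  apply: (@le_trans _ _ (\sum_(1 <= i < N.+1)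
      ((if (N.+1 - i <= t)%N then a N.+1 else 0) + D / (N.+1 - i)%:R ^+ 2))).
    rewrite big_nat [leRHS]big_nat; apply: ler_sum => i /andP[i1 iN].
    by apply: cb; rewrite // leqnn ltnW.
  rewrite (sum_nat_subnl
    (fun m => (if (m <= t)%N then _ else 0) + D / m%:R ^+ 2)).
  rewrite big_split/=; apply: lerD; last first.
    by rewrite -mulr_sumr mulrC ler_wpM2r// sum_inv_sqr_le2.
  (* The number of distances [m] with [1 <= m <= t] is at most [t]. *)
  rewrite -big_mkcond/= big_const_seq iter_addr_0 -[leLHS]mulr_natl ler_wpM2r//.
  rewrite ler_nat -size_filter.
  rewrite -[leqRHS](size_iota 1); apply: uniq_leq_size.
    by rewrite filter_uniq// iota_uniq.
  move=> m; rewrite mem_filter !mem_index_iota mem_iota add1n.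
  by move=> /and3P[? -> _].
rewrite -natr1; move: ih cNN row (a0 N.+1).
by set A := \sum_(1 <= i < N.+1) \sum_(1 <= j < N.+1) _; nra.
Qed.

(** * Almost everywhere convergence from variance bounds *)

(** If [v k <= m n < v k.+1], then [n] lies between [p k] and [p k.+1], and monotonicity puts
    [S n / m n] between [S (p k) / v k.+1] and [S (p k.+1) / v k]. Up to factors tending to 1, these
    are the ratios at [p k] and [p k.+1]. *)
Lemma cvg_interpolation (R : realType) (S m v : nat -> R) (p : nat -> nat) :
  (forall i j, (i <= j)%N -> S i <= S j) ->
  (forall i j, (i <= j)%N -> m i <= m j) ->
  (forall i, 0 <= S i) -> (forall k, 0 < v k) ->
  (forall k, v k <= v k.+1) -> v k @[k --> \oo] --> +oo ->
  v k.+1 / v k @[k --> \oo] --> (1 : R) ->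
  m n @[n --> \oo] --> +oo ->
  (forall k, v k <= m (p k) <= v k + 1) ->
  (forall n k, v k <= m n -> (p k <= n)%N) ->
  S (p k) / m (p k) @[k --> \oo] --> (1 : R) ->
  S n / m n @[n --> \oo] --> (1 : R).
Proof.
move=> Smono mmono S0 v0 vS voo vratio moo vm pmin Spm.
have vmono : nondecreasing_seq v by apply/nondecreasing_seqP.
have lo : S (p k) / m (p k) * (v k.+1 / v k)^-1 @[k --> \oo] --> (1 : R).
  rewrite -[X in _ --> X]mulr1 -[X in _ * X]invr1; apply: cvgM => //.
  exact: cvgV.
(* The term [(v k)^-1] pays for the overshoot [m (p k.+1) <= v k.+1 + 1]. *)
have hi : S (p k.+1) / m (p k.+1) * (v k.+1 / v k + (v k)^-1)
    @[k --> \oo] --> (1 : R).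
  rewrite -[X in _ --> X]mulr1 -[X in _ * X]addr0; apply: cvgM.
    by rewrite (cvg_shiftS (fun k => S (p k) / m (p k))).
  apply: cvgD => //; apply/gtr0_cvgV0; first exact: nearW.
  exact: voo.
apply/cvgrPdist_le => e e0.
have [K _ HK] : \forall k \near \oo,
   `|1 - S (p k) / m (p k) * (v k.+1 / v k)^-1| <= e /\
   `|1 - S (p k.+1) / m (p k.+1) * (v k.+1 / v k + (v k)^-1)| <= e.
  near=> k; split; near: k.
    by move/cvgrPdist_le : lo; apply.
  by move/cvgrPdist_le : hi; apply.
have : \forall n \near \oo, v K <= m n by move/cvgryPge : moo; apply.
apply: filterS => n vKn.
have ex : exists k, m n < v k.+1.
  move/cvgryPgt : voo => /(_ (m n)) [k0 _ /(_ k0.+1)/=] h.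
  by exists k0; apply: h => /=.
have [k mnk kmin] := ex_minnP ex.
have Kk : (K <= k)%N.
  rewrite leqNgt; apply/negP => kK; have := le_lt_trans vKn mnk.
  by rewrite ltNge vmono.
(* For [k > K] this is the minimality of [k]; otherwise [v k <= v K <= m n]. *)
have vkn : v k <= m n.
  case: (ltnP K k) => [Kk1|kK]; last by rewrite (le_trans _ vKn)// vmono.
  rewrite leNgt; apply/negP; case: k Kk1 {mnk Kk} kmin => // k _ kmin.
  by move=> /kmin; rewrite ltnn.
have [hlo hhi] := HK k Kk.
have /andP[v1 v2] := vm k; have /andP[v3 v4] := vm k.+1.
have pn := pmin _ _ vkn.
have np : (n <= p k.+1)%N.
  rewrite leqNgt; apply/negP => /ltnW/mmono; rewrite leNgt => /negP; apply.
  exact: lt_le_trans mnk v3.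
have m0 : 0 < m n by apply: lt_le_trans vkn.
have mk0 : 0 < m (p k) by apply: lt_le_trans v1.
have mk10 : 0 < m (p k.+1) by apply: lt_le_trans v3.
have A : v k / m (p k) <= 1 by rewrite ler_pdivrMr// mul1r.
have B : (v k.+1)^-1 <= (m n)^-1 by rewrite lef_pV2 ?posrE// ltW.
have hl : S (p k) / m (p k) * (v k.+1 / v k)^-1 <= S n / m n.
  rewrite invf_div.
  rewrite (_ : _ * _ = S (p k) * (v k / m (p k)) / v k.+1); last by ring.
  apply: ler_pM => //;
    rewrite ?invr_ge0 ?mulr_ge0 ?invr_ge0 ?(ltW (v0 _)) ?(ltW mk0)//.
  rewrite -[leRHS]mulr1; apply: ler_pM => //; last exact: Smono.
  by rewrite divr_ge0 ?ltW.
have hr : S n / m n <= S (p k.+1) / m (p k.+1) * (v k.+1 / v k + (v k)^-1).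
  have -> : S (p k.+1) / m (p k.+1) * (v k.+1 / v k + (v k)^-1) =
      S (p k.+1) * ((v k.+1 + 1) / m (p k.+1)) / v k by ring.
  apply: ler_pM; rewrite ?invr_ge0 ?S0 ?(ltW m0)//; last first.
    by rewrite lef_pV2 ?posrE.
  rewrite -[leLHS]mulr1; apply: ler_pM => //; first exact: Smono.
  by rewrite ler_pdivlMr// mul1r.
rewrite ler_distlC; move: hlo hhi; rewrite !ler_distlC.
by move=> /andP[h1 _] /andP[_ h2]; rewrite (le_trans h1 hl) (le_trans hr h2).
Unshelve. all: by end_near. Qed.

Lemma Rintegral_cst_probability (d : measure_display) (T : measurableType d)
    (R : realType) (mu : probability T R) (c : R) : \int[mu]_x c = c.
Proof.
rewrite Rintegral_cst//; transitivity (c * fine (1%E : \bar R)).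
  by congr (_ * fine _); exact: probability_setT.
by rewrite mulr1.
Qed.

Lemma bounded_integrable (d : measure_display) (T : measurableType d)
    (R : realType) (mu : probability T R) (f : T -> R) (M : R) :
  measurable_fun [set: T] f -> (forall x, `|f x| <= M) ->
  mu.-integrable [set: T] (EFin \o f).
Proof.
move=> mf fM; apply: measurable_bounded_integrable => //.
  by rewrite (le_lt_trans (probability_le1 _ _)) ?ltry.
exists M; split; first exact: num_real.
by move=> y My x _ /=; rewrite (le_trans (fM x))// ltW.
Qed.

Lemma nneseries_lty_cvg0 (R : realType) (y : nat -> R) :
  (forall k, 0 <= y k) -> (\sum_(k <oo) (y k)%:E < +oo)%E ->
  y k @[k --> \oo] --> (0 : R).
Proof.
move=> y0 yoo; apply: cvg_series_cvg_0; apply: nondecreasing_is_cvgn.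
  by apply/nondecreasing_seqP => n; rewrite /series/= big_nat_recr//= lerDl.
exists (fine (\sum_(k <oo) (y k)%:E)%E) => _ [n _ <-].
rewrite -lee_fin fineK; last first.
  by rewrite ge0_fin_numE// nneseries_ge0// => n' _ _; rewrite lee_fin.
by rewrite /series/= -sumEFin; apply: nneseries_lim_ge => i _ _; rewrite lee_fin.
Qed.

(** Integrating the series term by term bounds its integral by [b], so it is finite almost
    everywhere and its terms tend to 0. *)
Lemma ae_cvg0_summable (d : measure_display) (T : measurableType d)
    (R : realType) (mu : probability T R) (Y : nat -> T -> R) (b : R) :
  (forall k, measurable_fun [set: T] (Y k)) -> (forall k x, 0 <= Y k x) ->
  (forall k, mu.-integrable [set: T] (EFin \o Y k)) ->
  (forall n, \sum_(0 <= k < n) \int[mu]_x Y k x <= b) ->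
  {ae mu, forall x, Y k x @[k --> \oo] --> (0 : R)}.
Proof.
move=> mY Y0 iY Yb.
pose F : T -> \bar R := fun x => (\sum_(k <oo) (Y k x)%:E)%E.
have mF : measurable_fun [set: T] F.
  by apply: ge0_emeasurable_sum => *; [rewrite lee_fin|apply/measurable_EFinP].
have F0 x : (0 <= F x)%E.
  by apply: nneseries_ge0 => *; rewrite lee_fin.
have iF : mu.-integrable [set: T] F.
  apply/integrableP; split => //.
  under eq_integral do rewrite gee0_abs//.
  rewrite integral_nneseries//; last 2 first.
  - by move=> n; apply/measurable_EFinP.
  - by move=> *; rewrite lee_fin.
  rewrite (@le_lt_trans _ _ b%:E) ?ltry//.
  apply: lime_le.
    by apply: is_cvg_nneseries => *; apply: integral_ge0 => *; rewrite lee_fin.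
  apply: nearW => n.
  rewrite (eq_bigr (fun k => (\int[mu]_x Y k x)%:E)) ?sumEFin ?lee_fin//.
  move=> k _; rewrite /Rintegral fineK//; exact: (integrable_fin_num _ (iY k)).
move: (integrable_ae measurableT iF); apply: filterS => x /(_ Logic.I) Fx.
by apply: nneseries_lty_cvg0 => //; rewrite -[X in (X < _)%E]/(F x) -ge0_fin_numE.
Qed.

Lemma ae_cvg_of_variance (d : measure_display) (T : measurableType d)
    (R : realType) (mu : probability T R) (g : nat -> T -> R) (C s : R) :
  let m := fun n => \sum_(1 <= k < n.+1) \int[mu]_x g k x in
  let S := fun n x => \sum_(1 <= k < n.+1) g k x in
  (forall k, measurable_fun [set: T] (g k)) ->
  (forall k x, 0 <= g k x <= 1) ->
  m n @[n --> \oo] --> +oo -> 0 <= C -> s < 2 ->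
  (\forall n \near \oo, \int[mu]_x (S n x - m n) ^+ 2 <= C * m n `^ s) ->
  {ae mu, forall x, S n x / m n @[n --> \oo] --> (1 : R)}.
Proof.
move=> m S mg g01 moo C0 s2 [n0 _ var].
have ig k : mu.-integrable [set: T] (EFin \o g k).
  apply: (@bounded_integrable _ _ _ _ _ 1) => // x.
  by have /andP[g0 g1] := g01 k x; rewrite ger0_norm.
have a0 k : 0 <= \int[mu]_x g k x.
  by apply: Rintegral_ge0 => x _; have /andP[] := g01 k x.
have a1 k : \int[mu]_x g k x <= 1.
  apply: (@le_trans _ _ (\int[mu]_x (cst 1 x))).
    apply: le_Rintegral => // [|x _]; last by have /andP[] := g01 k x.
    exact: finite_measure_integrable_cst.
  by rewrite Rintegral_cst_probability.
have mmono : nondecreasing_seq m.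
  by apply/nondecreasing_seqP => n; rewrite /m [leRHS]big_nat_recr//= lerDl.
have Smono x : nondecreasing_seq (S ^~ x).
  apply/nondecreasing_seqP => n; rewrite /S [leRHS]big_nat_recr//= lerDl.
  by have /andP[] := g01 n.+1 x.
have m0 n : 0 <= m n by rewrite /m sumr_ge0.
have S0 n x : 0 <= S n x by rewrite /S sumr_ge0// => k _; have /andP[] := g01 k x.
have mS n : measurable_fun [set: T] (S n) by exact: measurable_sum.
have Sn n x : S n x <= n%:R.
  have -> : n%:R = \sum_(1 <= k < n.+1) (1 : R) by rewrite sumr_const_nat subn1.
  apply: ler_sum => k _.
  by have /andP[] := g01 k x.
(* Along the times [p k] at which [m] first reaches [(k + 1) ^ L], the
   normalised variances are at most [C / (k + 1) ^ 2], hence summable. *)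
pose L := (Num.truncn (2 / (2 - s))).+1.
have L2 : 2 <= L%:R * (2 - s).
  by rewrite -ler_pdivrMr ?subr_gt0// ltW// truncnS_gt.
pose v k : R := k.+1%:R ^+ L.
have v0 k : 0 < v k by rewrite exprn_gt0// ltr0n.
have vS k : v k <= v k.+1 by rewrite lerXn2r// ?nnegrE ?ler_nat ?ler0n.
have voo : v k @[k --> \oo] --> +oo.
  apply: (@ger_cvgy _ _ _ _ (fun k => k%:R)); last exact: cvgr_idn.
  apply: nearW => k; apply: (@le_trans _ _ k.+1%:R); first by rewrite ler_nat.
  by rewrite /v -[leLHS]expr1 ler_weXn2l// ler1n.
have vratio : v k.+1 / v k @[k --> \oo] --> (1 : R).
  rewrite /v; under eq_fun do rewrite -expr_div_n.
  have := @continuous_cvg _ R R \oo _ (fun k : nat => k.+2%:R / k.+1%:R : R)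
    (fun x : R => x ^+ L) 1 (@exprn_continuous R L 1).
  rewrite expr1n; apply.
  have : 1 + (k.+1%:R^-1 : R) @[k --> \oo] --> (1 + 0 : R).
    by apply: cvgD; [exact: cvg_cst|exact: cvg_harmonic].
  rewrite addr0; apply: cvg_trans; apply: near_eq_cvg; apply: nearW => k.
  by rewrite -[k.+2%:R]natr1 mulrDl divff ?pnatr_eq0// mul1r.
have vex k : exists n, v k <= m n.
  by move/cvgryPge : moo => /(_ (v k)) [N _ /(_ N)/=] h; exists N; apply: h => /=.
pose p k := ex_minn (vex k).
(* Each summand of [m] is at most 1, which bounds the overshoot; [p k] is not 0 because
   [m 0 = 0 < v k]. *)
have vm k : v k <= m (p k) <= v k + 1.
  rewrite /p; case: ex_minnP => -[|n] vn nmin.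
    by move: vn; rewrite /m big_geq// leNgt v0.
  rewrite vn/= /m big_nat_recr//= lerD//= leNgt; apply/negP => /ltW/nmin.
  by rewrite ltnn.
have pmin n k : v k <= m n -> (p k <= n)%N.
  by rewrite /p; case: ex_minnP => n' _ h /h.
have mp0 k : 0 < m (p k) by have /andP[/(lt_le_trans (v0 k))] := vm k.
pose Y k x := (S (p k) x / m (p k) - 1) ^+ 2.
have YE k x : Y k x = (m (p k) ^+ 2)^-1 * (S (p k) x - m (p k)) ^+ 2.
  by rewrite /Y -exprVn -exprMn; congr (_ ^+ 2); field; rewrite gt_eqF.
have mSm n : measurable_fun [set: T] (fun x => (S n x - m n) ^+ 2).
  by apply: measurable_funX; apply: measurable_funB.
have iSm n : mu.-integrable [set: T] (EFin \o (fun x => (S n x - m n) ^+ 2)).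
  apply: (@bounded_integrable _ _ _ _ _ ((n%:R + m n) ^+ 2)) => // x.
  rewrite ger0_norm ?sqr_ge0// -ler_sqrt ?sqr_ge0// !sqrtr_sqr.
  rewrite [leRHS]ger0_norm ?addr_ge0// ler_norml.
  have := Sn n x; have := S0 n x; have := m0 n.
  by have : 0 <= n%:R :> R := ler0n _ _; lra.
(* The mean of [Y k] is at most [C / m (p k) ^ (2 - s)], and [m (p k) ^ (2 - s) >= k.+1 ^ (L * (2 -
   s)) >= k.+1 ^ 2]. *)
have YI k : (n0 <= p k)%N -> \int[mu]_x Y k x <= C * (k.+1%:R ^+ 2)^-1.
  move=> n0p; under eq_Rintegral do rewrite YE.
  rewrite RintegralZl// mulrC ler_pdivrMr ?exprn_gt0//.
  apply: (le_trans (var _ n0p)); rewrite -mulrA ler_wpM2l//.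
  rewrite ler_pdivlMl ?exprn_gt0 ?ltr0n//.
  have -> : m (p k) ^+ 2 = m (p k) `^ (2 - s) * m (p k) `^ s.
    rewrite -powRD ?subrK -?powR_mulrn ?m0//.
    by rewrite (gt_eqF (mp0 k)) implybT.
  rewrite ler_wpM2r ?powR_ge0//.
  have k1 : 1 <= k.+1%:R :> R by rewrite ler1n.
  apply: (@le_trans _ _ (v k `^ (2 - s))); last first.
    have /andP[vk _] := vm k.
    by rewrite ge0_ler_powR ?nnegrE ?subr_ge0 ?(ltW s2) ?(ltW (v0 k)) ?m0.
  by rewrite /v -!powR_mulrn ?ler0n// -powRrM ler_powR.
(* The variance bound starts at [n0]; a shift by [K] moves every time [p (k + K)] beyond it. *)
have [K _ HK] : \forall k \near \oo, m n0 < v k by move/cvgryPgt : voo; apply.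
have n0p k : (n0 <= p (k + K))%N.
  rewrite leqNgt; apply/negP => /ltnW/mmono.
  have /andP[vk _] := vm (k + K)%N; apply/negP; rewrite -ltNge.
  by rewrite (lt_le_trans _ vk)// HK//= leq_addl.
have mY k : measurable_fun [set: T] (Y k).
  by apply: measurable_funX; apply: measurable_funB => //; exact: measurable_funM.
have iY k : mu.-integrable [set: T] (EFin \o Y k).
  rewrite (_ : _ \o _ = (fun x => ((m (p k) ^+ 2)^-1)%R%:E *
      ((S (p k) x - m (p k)) ^+ 2)%R%:E)%E).
    exact: (integrableZl measurableT _ (iSm (p k))).
  by apply/funext => x /=; rewrite YE EFinM.
have Ycvg : {ae mu, forall x, Y (k + K)%N x @[k --> \oo] --> (0 : R)}.
  apply: (@ae_cvg0_summable _ _ _ _ _ (C * 2)) => // [k x|n].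
    exact: sqr_ge0.
  apply: (@le_trans _ _ (C * \sum_(1 <= k < n.+1) (k%:R ^+ 2)^-1)); last first.
    by rewrite ler_wpM2l// sum_inv_sqr_le2.
  rewrite mulr_sumr big_add1/=; apply: ler_sum => k _.
  apply: (le_trans (YI _ (n0p k))); rewrite ler_wpM2l//.
  rewrite lef_pV2 ?posrE ?exprn_gt0 ?ltr0n// lerXn2r ?nnegrE ?ler0n//.
  by rewrite ler_nat ltnS leq_addr.
move: Ycvg; apply: filterS => x Yx.
apply: (@cvg_interpolation _ (S ^~ x) m v p) => //; first exact: Smono.
apply/cvgrPdistC_lt => e e0.
have : \forall k \near \oo, Y (k + K)%N x < e ^+ 2.
  move/cvgr_lt : Yx; apply; exact: exprn_gt0.
move=> [k1 _ Hk1]; exists (k1 + K)%N => // k /= k1K.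
have /Hk1/= : (k1 <= k - K)%N.
  by rewrite leq_subRL ?(leq_trans (leq_addl _ _) k1K)// addnC.
rewrite subnK ?(leq_trans (leq_addl _ _) k1K)// /Y => h.
by rewrite -(@ltr_pXn2r _ 2)// ?nnegrE ?(ltW e0)// -normrX ger0_norm ?sqr_ge0.
Qed.

(** * Powers of n and growth exponents *)

Lemma limn_einf_gt_near (R : realType) (u : nat -> R) (b z : R) :
  limn_einf (fun n => (u n)%:E) = z%:E -> b < z -> \forall n \near \oo, b < u n.
Proof.
rewrite limn_einf_lim => uz bz.
have : (b%:E < ereal_sup (range (einfs (fun n => (u n)%:E))))%E.
  by rewrite -(cvg_lim _ (@cvg_einfs_sup R _))// uz lte_fin.
move=> /ereal_sup_gt[_ [n _ <-]] bn; exists n => // k /= nk.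
rewrite -lte_fin (lt_le_trans bn)//; apply: ereal_inf_lbound.
by exists k.
Qed.

(** As [ln] is 0 at nonpositive reals, the ratio does not force [u n] to be positive when [b < 0];
    hence the premise [0 < u n]. *)
Lemma ratio_ln_gt_near (R : realType) (u : nat -> R) (b z : R) :
  limn_einf (fun n => (ln (u n) / ln n%:R)%:E) = z%:E -> b < z ->
  \forall n \near \oo, 0 < u n -> n%:R `^ b < u n.
Proof.
move=> uz bz; have [n0 _ H] := limn_einf_gt_near uz bz.
exists (maxn 2 n0) => // n /=; rewrite geq_max => /andP[n2 n0n] un.
have lnn : 0 < ln (n%:R : R) by rewrite ln_gt0// ltr1n.
move: (H _ n0n); rewrite /= ltr_pdivlMr// -ln_powR ltr_ln// posrE.
by rewrite powR_gt0// ltr0n ltnW.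
Qed.

Lemma cvgry_powR_nat (R : realType) (b : R) : 0 < b ->
  (n%:R `^ b : R) @[n --> \oo] --> +oo.
Proof.
move=> b0; apply/cvgryPge => A; near=> n.
have [A0|A0] := leP A 0; first by rewrite (le_trans A0)// powR_ge0.
have -> : A = (A `^ b^-1) `^ b by rewrite -powRrM mulVf ?powRr1 ?gt_eqF ?ltW.
apply: (ge0_ler_powR (ltW b0)); rewrite ?nnegrE ?powR_ge0 ?ler0n//.
near: n; move/cvgryPge : (@cvgr_idn R); exact.
Unshelve. all: by end_near. Qed.

(** Ensures that the integer parts of the [n ^ a] skip no integer. With [q = n / (n + 1)], both
    [(n + 1) ^ a <= n + 1] and [1 - q ^ a <= 1 - q] hold, and [(n + 1) * (1 - q) = 1]. *)
Lemma powR_succ_le (R : realType) (a : R) n :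
  0 < a <= 1 -> n.+1%:R `^ a <= n%:R `^ a + 1 :> R.
Proof.
move=> /andP[a0 a1]; have n1 : 0 < n.+1%:R :> R by rewrite ltr0n.
have [->|n0] := eqVneq n 0%N.
  by rewrite powR0 ?gt_eqF// add0r powR1.
set q : R := n%:R / n.+1%:R.
have q0 : 0 < q by rewrite divr_gt0// ltr0n lt0n.
have q1 : q <= 1 by rewrite ler_pdivrMr// mul1r ler_nat.
have -> : n%:R = n.+1%:R * q :> R by rewrite mulrC divfK// gt_eqF.
rewrite powRM ?(ltW n1) ?(ltW q0)//.
have qa : q <= q `^ a by rewrite ger1_powR// q0.
have na : n.+1%:R `^ a <= n.+1%:R :> R by rewrite ler1_powR// ler1n.
have nq : n.+1%:R * (1 - q) = 1.
  by rewrite mulrBr mulr1 mulrC divfK ?gt_eqF// -natr1 addrAC subrr add0r.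
have na0 := powR_ge0 (n.+1%:R : R) a.
have qa1 : q `^ a <= 1.
  have := ge0_ler_powR (ltW a0) (ltW q0) (@ler01 R) q1.
  by rewrite powR1.
have : n.+1%:R `^ a * (1 - q `^ a) <= n.+1%:R * (1 - q).
  by apply: ler_pM => //; rewrite ?subr_ge0// lerD2l lerN2.
by rewrite nq mulrBr mulr1 lerBlDl.
Qed.

(** The term added at each induction step is at most each of the first [N.+1] terms. *)
Lemma sum_average_le (R : realFieldType) (a : nat -> R) N n :
  (forall i j, (i <= j)%N -> a j <= a i) -> (N <= n)%N ->
  N.+1%:R * \sum_(0 <= i < n.+1) a i <= n.+1%:R * \sum_(0 <= i < N.+1) a i.
Proof.
move=> adec; elim: n => [|n ih] Nn.
  by move: Nn; rewrite leqn0 => /eqP->.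
move: Nn; rewrite leq_eqVlt => /predU1P[->//|]; rewrite ltnS => Nn.
rewrite (big_nat_recr n.+1)//= mulrDr -[in leRHS]natr1 mulrDl mul1r.
apply: lerD; first exact: ih.
have -> : N.+1%:R * a n.+1 = \sum_(0 <= i < N.+1) a n.+1.
  by rewrite sumr_const_nat subn0 mulr_natl.
apply: ler_sum_nat => i /andP[_ iN]; apply: adec.
by rewrite (leq_trans (ltnW iN)).
Qed.

(** * Pointwise decay from the summability condition *)

Lemma decay_rate_of_summand_bound (R : realType) (Phi M : nat -> R)
    (alpha eps c A : R) (N j : nat) :
  0 < alpha -> 2 * alpha <= 1 -> c <= -1 -> 0 <= eps -> 0 <= A ->
  (forall n, 0 <= Phi n) ->
  (forall n, (1 <= n)%N -> n%:R `^ (2 - 2 * c + eps) *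
     (Phi (Num.truncn (n%:R `^ alpha : R)) / M n ^+ 2) <= A) ->
  (forall n, (N <= n)%N -> 0 < M n) ->
  (forall n, (N <= n)%N -> N%:R * M n <= 2 * n%:R * M N) ->
  (1 <= N)%N -> N%:R `^ alpha < j%:R ->
  Phi j * N%:R `^ (- 2 * c + eps) <=
    4 * A * M N ^+ 2 * N%:R `^ (2 * alpha - 2) / j%:R ^+ 2.
Proof.
move=> a0 a1 c1 e0 A0 Phi0 hA M0 Mavg N1 Nj.
(* For the least [n] with [j <= n ^ alpha], the integer part of [n ^ alpha] is
   [j], so the [n]-th summand controls [Phi j]; moreover [N < n]. *)
have ex : exists n, j%:R <= n%:R `^ alpha :> R.
  move/cvgryPge : (cvgry_powR_nat a0) => /(_ j%:R) [n _ /(_ n (leqnn n))].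
  by exists n.
have [n jn nmin] := ex_minnP ex.
have Nn : (N < n)%N.
  rewrite ltnNge; apply/negP => nN; move: Nj; apply/negP; rewrite -leNgt.
  by rewrite (le_trans jn)// (ge0_ler_powR (ltW a0)) ?nnegrE ?ler0n ?ler_nat.
have n0 : (0 < n)%N by rewrite (leq_ltn_trans _ Nn).
have nR0 : 0 < n%:R :> R by rewrite ltr0n.
have NR0 : 0 < N%:R :> R by rewrite ltr0n.
have jR0 : 0 < j%:R :> R by rewrite (le_lt_trans _ Nj)// powR_ge0.
(* Minimality gives [(n - 1) ^ alpha < j], and the next power is larger by at most 1. *)
have tj : Num.truncn (n%:R `^ alpha : R) = j.
  apply: truncn_def; rewrite jn/=.
  case: n jn nmin n0 {Nn nR0} => // n _ nmin _.
  apply: (le_lt_trans (powR_succ_le n _)); first by apply/andP; split; lra.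
  rewrite -natr1 ltrD2r ltNge; apply/negP => /nmin; rewrite ltnn//.
have MN0 := M0 N (leqnn N); have Mn0 := M0 n (ltnW Nn).
have := hA n n0; rewrite tj mulrA ler_pdivrMr ?exprn_gt0// => hPhi.
have hM : M n ^+ 2 * N%:R ^+ 2 <= 4 * n%:R ^+ 2 * M N ^+ 2.
  rewrite -exprMn (_ : 4 * _ * _ = (2 * n%:R * M N) ^+ 2); last by ring.
  rewrite lerXn2r ?nnegrE ?mulr_ge0 ?(ltW nR0) ?(ltW MN0) ?(ltW Mn0)// mulrC.
  exact: Mavg (ltnW Nn).
(* The exponent of (iii) is [2 + 2 * alpha + x]: [n ^ 2] pays for replacing [M n] by [M N],
   [n ^ (2 * alpha)] dominates [j ^ 2], and [n ^ x] dominates [N ^ x] since [x >= 0]. *)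
pose x := - (2 * alpha + 2 * c - eps).
have e1 : (n%:R : R) `^ (2 - 2 * c + eps) = n%:R ^+ 2 * n%:R `^ (2 * alpha)
    * n%:R `^ x.
  rewrite -powR_mulrn ?ler0n// -!powRD ?(gt_eqF nR0) ?implybT//.
  by congr (_ `^ _); rewrite /x; ring.
have e2 : (N%:R : R) `^ (2 * alpha - 2) = (N%:R `^ x)^-1
    * N%:R `^ (- 2 * c + eps) / N%:R ^+ 2.
  rewrite -powR_mulrn ?ler0n// -!powRN -!powRD ?(gt_eqF NR0) ?implybT//.
  by congr (_ `^ _); rewrite /x; ring.
have je : j%:R ^+ 2 <= (n%:R : R) `^ (2 * alpha).
  rewrite mulrC powRrM powR_mulrn ?powR_ge0// lerXn2r ?nnegrE ?powR_ge0//.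
have x0 : 0 <= x by rewrite /x; lra.
have Nnx : (N%:R : R) `^ x <= n%:R `^ x.
  by rewrite ge0_ler_powR ?nnegrE ?ler0n// ler_nat ltnW.
have Nx0 : 0 < (N%:R : R) `^ x by rewrite powR_gt0.
rewrite e1 in hPhi; rewrite e2.
have Y0 := powR_ge0 (N%:R : R) (- 2 * c + eps).
set Y := _ `^ (- 2 * c + eps) in Y0 *.
have -> : 4 * A * M N ^+ 2 * ((N%:R `^ x)^-1 * Y / N%:R ^+ 2) / j%:R ^+ 2 =
    4 * A * M N ^+ 2 / (N%:R `^ x * N%:R ^+ 2 * j%:R ^+ 2) * Y.
  by field; rewrite ?gt_eqF.
apply: ler_wpM2r => //; rewrite ler_pdivlMr ?mulr_gt0 ?exprn_gt0//.
have nn0 : 0 < n%:R ^+ 2 :> R by rewrite exprn_gt0.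
rewrite -(ler_pM2l nn0).
apply: (@le_trans _ _ (A * M n ^+ 2 * N%:R ^+ 2)).
  apply: le_trans (ler_wpM2r (sqr_ge0 _) hPhi).
  have -> : n%:R ^+ 2 * (Phi j * (N%:R `^ x * N%:R ^+ 2 * j%:R ^+ 2)) =
    n%:R ^+ 2 * (Phi j * N%:R ^+ 2) * (j%:R ^+ 2 * N%:R `^ x) by ring.
  have -> : n%:R ^+ 2 * n%:R `^ (2 * alpha) * n%:R `^ x * Phi j * N%:R ^+ 2 =
    n%:R ^+ 2 * (Phi j * N%:R ^+ 2) * (n%:R `^ (2 * alpha) * n%:R `^ x) by ring.
  apply: ler_wpM2l; first by rewrite !mulr_ge0 ?sqr_ge0.
  by apply: ler_pM => //; rewrite ?sqr_ge0// ltW.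
have -> : n%:R ^+ 2 * (4 * A * M N ^+ 2) = A * (4 * n%:R ^+ 2 * M N ^+ 2) by ring.
by rewrite -mulrA ler_wpM2l.
Qed.

(** * Invariance of integrals *)

Lemma measure_preserving_iter (d : measure_display) (R : realType)
    (X : measurableType d) (mu : {measure set X -> \bar R}) (T : X -> X) n :
  measure_preserving mu T -> measure_preserving mu (iter n T).
Proof.
move=> [mT muT]; elim: n => [|n [mTn muTn]].
  by split => //; exact: measurable_id.
split; first exact: (measurableT_comp mT mTn).
move=> A mA; rewrite -[RHS]muT// -[RHS]muTn//.
by rewrite -[X in measurable X]setTI; exact: mT.
Qed.

Lemma Rintegral_measure_preserving (d : measure_display) (R : realType)
    (X : measurableType d) (mu : probability X R) (T : X -> X)
    (F : X -> R) (M : R) :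
  measure_preserving mu T -> measurable_fun [set: X] F ->
  (forall x, `|F x| <= M) ->
  \int[mu]_x F (T x) = \int[mu]_x F x.
Proof.
move=> [mT muT] mF FM; congr fine.
have mFE : measurable_fun [set: X] (EFin \o F) by exact/measurable_EFinP.
have iFT : mu.-integrable (T @^-1` [set: X]) ((EFin \o F) \o T).
  rewrite preimage_setT.
  apply: (@bounded_integrable _ _ _ mu (F \o T) M) => [|x]; last exact: FM.
  exact: (measurableT_comp mF mT).
have := @integral_pushforward _ _ _ _ _ _ mT mu _ _ mFE iFT measurableT.
rewrite preimage_setT => <-.
by apply: eq_measure_integral => A mA _; exact: muT.
Qed.

(** * Lipschitz ramps around balls *)

Lemma metric_ball_open (R : realType) (X : metricType R) (x : X) (a : R) :
  open (ball x a).
Proof.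
rewrite openE => y; rewrite /interior ballEmdist/= => ya.
apply/nbhs_ballP; exists (a - mdist x y) => /=; first by rewrite subr_gt0.
move=> z; rewrite !ballEmdist/= => yz.
by have := metric_triangle x y z; lra.
Qed.

(** Stands in for the indicator of a ball, which need not be Lipschitz; the intended case is
    [a < b]. *)
Definition ramp (R : realType) (X : metricType R) (x0 : X) (a b : R)
    (x : X) : R :=
  Num.min 1 (Num.max 0 ((b - mdist x0 x) / (b - a))).

Section ramp.
Context (R : realType).

Lemma ramp_ge0 (X : metricType R) (x0 : X) a b x : 0 <= ramp x0 a b x.
Proof. by rewrite /ramp le_min ler01 le_max lexx. Qed.

Lemma ramp_le1 (X : metricType R) (x0 : X) a b x : ramp x0 a b x <= 1.
Proof. by rewrite /ramp ge_min lexx. Qed.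

Lemma indic_le_ramp (X : metricType R) (x0 : X) a b x : a < b ->
  \1_(ball x0 a) x <= ramp x0 a b x.
Proof.
move=> ab; rewrite indicE; case: (boolP (x \in _)) => [|_]; last exact: ramp_ge0.
rewrite inE ballEmdist/= => xa; rewrite /ramp le_min lexx/= le_max.
by apply/orP; right; rewrite ler_pdivlMr ?subr_gt0//; lra.
Qed.

Lemma ramp_le_indic (X : metricType R) (x0 : X) a b x : a < b ->
  ramp x0 a b x <= \1_(ball x0 b) x.
Proof.
move=> ab; rewrite indicE; case: (boolP (x \in _)) => [_|]; first exact: ramp_le1.
rewrite notin_setE ballEmdist/= => /negP; rewrite -leNgt => bx.
rewrite /ramp ge_min ge_max lexx/=; apply/orP; right.
by rewrite pmulr_lle0 ?invr_gt0; lra.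
Qed.

(** The distance to [x0] is 1-Lipschitz, and clamping to the unit interval does not increase
    differences. *)
Lemma ramp_lipschitz (X : metricType R) (x0 : X) a b x y : a < b ->
  `|ramp x0 a b x - ramp x0 a b y| <= (b - a)^-1 * mdist x y.
Proof.
move=> ab; have ba0 : 0 < (b - a)^-1 by rewrite invr_gt0 subr_gt0.
have : `|mdist x0 x - mdist x0 y| <= mdist x y.
  have := metric_triangle x0 x y; have := metric_triangle x0 y x.
  by rewrite (metric_sym y x) ler_norml => *; apply/andP; split; lra.
rewrite -(ler_pM2l ba0); apply: le_trans.
rewrite -[in leRHS](gtr0_norm ba0) -normrM mulrBr.
have -> : (b - a)^-1 * mdist x0 x - (b - a)^-1 * mdist x0 y =
  (b - mdist x0 y) / (b - a) - (b - mdist x0 x) / (b - a) by ring.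
rewrite distrC /ramp; move: (_ / _) => u; move: (_ / _) => v.
have := ler_norm (v - u); have := ler_norm (u - v); rewrite (distrC v).
rewrite ler_norml; move: (`|u - v|) => w uw vw.
case: (leP 0 u) => u0; case: (leP 0 v) => v0; rewrite ?(min_r ler01);
  case: (leP 1 u) => u1; case: (leP 1 v) => v1; apply/andP; split; lra.
Qed.

Lemma lipschitz_norm_ramp (X : metricType R) (x0 : X) a b : a < b ->
  (lipschitz_norm (ramp x0 a b) <= (1 + (b - a)^-1)%:E)%E.
Proof.
move=> ab; rewrite /lipschitz_norm EFinD; apply: leeD.
  apply: ge_ereal_sup => _ [x _ <-].
  by rewrite lee_fin ger0_norm ?ramp_ge0// ramp_le1.
apply: ereal_inf_lbound; exists (b - a)^-1 => //; split.
  by rewrite invr_ge0 subr_ge0 ltW.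
by move=> x y; exact: ramp_lipschitz.
Qed.

Lemma measurable_metric_ball (d : measure_display) (X : measurableMetricType d R)
  (x0 : X) a : borel X -> measurable (ball x0 a).
Proof.
by move=> ->; apply: sub_sigma_algebra; exact: metric_ball_open.
Qed.

Lemma measurable_ramp (d : measure_display) (X : measurableMetricType d R)
  (x0 : X) a b : borel X -> measurable_fun [set: X] (ramp x0 a b : X -> R).
Proof.
move=> Xb; apply: measurable_minr => //; apply: measurable_maxr => //.
apply: measurable_funM => //; apply: measurable_funB => //.
(* Measurability of the distance is tested on open lower rays, whose preimages are balls. *)
apply: (measurability _ (RGenInftyO.measurableE R)) => _ [_ [x ->] <-].
rewrite setTI (_ : _ @^-1` _ = ball x0 x); first exact: measurable_metric_ball.
by rewrite ballEmdist; apply/seteqP; split => y /=; rewrite in_itv.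
Qed.

End ramp.

(** * Covariances and variance *)

Lemma Rintegral_sum (d : measure_display) (R : realType) (X : measurableType d)
    (mu : {measure set X -> \bar R}) (I : Type) (s : seq I) (F : I -> X -> R) :
  (forall i, mu.-integrable [set: X] (EFin \o F i)) ->
  \int[mu]_x (\sum_(i <- s) F i x) = \sum_(i <- s) \int[mu]_x F i x.
Proof.
move=> iF; elim: s => [|i s ih].
  rewrite big_nil; under eq_Rintegral do rewrite big_nil.
  by rewrite Rintegral_cst// mul0r.
rewrite big_cons -ih; under eq_Rintegral do rewrite big_cons.
rewrite RintegralD//.
rewrite (_ : _ \o _ = (fun x => \sum_(j <- s) (F j x)%:E)%E).
  by apply: integrable_sum => // j _; exact: iF.
by apply/funext => x /=; rewrite -sumEFin.
Qed.

(** The point [x0] excludes the empty space, where the supremum is [-oo]. *)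
Lemma lipschitz_norm_ge0 (R : realType) (X : metricType R) (x0 : X)
    (phi : X -> R) : (0 <= lipschitz_norm phi)%E.
Proof.
apply: adde_ge0; last first.
  by apply: le_ereal_inf_tmp => _ [l [l0 _] <-]; rewrite lee_fin.
apply: (@le_trans _ _ `|phi x0|%:E); first by rewrite lee_fin.
by apply: ereal_sup_ubound; exists x0.
Qed.

Lemma decay_of_correlations_le (d : measure_display) (R : realType)
    (X : measurableMetricType d R) (x0 : X) (mu : probability X R) (T : X -> X)
    (Phi : nat -> R) (phi psi : X -> R) (k l : R) n :
  decay_of_correlations mu T Phi -> (forall n, 0 <= Phi n) ->
  (lipschitz_norm phi <= k%:E)%E -> (lipschitz_norm psi <= l%:E)%E ->
  (1 <= n)%N ->
  \int[mu]_x (phi (iter n T x) * psi x) - (\int[mu]_x phi x) * \int[mu]_x psi x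
    <= k * l * Phi n.
Proof.
move=> dec Phi0 phik psil n1; apply: (le_trans (ler_norm _)).
have := dec phi psi (le_lt_trans phik (ltry _)) (le_lt_trans psil (ltry _)) n n1.
rewrite -lee_fin => /le_trans; apply; rewrite EFinM lee_wpmul2r ?lee_fin//.
by rewrite EFinM lee_pmul ?(lipschitz_norm_ge0 x0).
Qed.

Section correlations.
Context (d : measure_display) (R : realType) (X : measurableMetricType d R).
Context (x0 : X) (mu : probability X R) (T : X -> X) (Phi : nat -> R).
Context (f : nat -> X -> R) (l : nat -> R).
Context (T_mu : measure_preserving mu T)
  (T_decay : decay_of_correlations mu T Phi) (Phi_ge0 : forall n, 0 <= Phi n).
Context (mf : forall k, measurable_fun [set: X] (f k))
  (f01 : forall k x, 0 <= f k x <= 1)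
  (fl : forall k, (1 <= k)%N -> (lipschitz_norm (f k) <= (l k)%:E)%E).

Let g k x := f k (iter k T x).
Let a k := \int[mu]_x f k x.
(** Covariances: by invariance [a k] is the mean of [g k]. *)
Let c i j := \int[mu]_x ((g i x - a i) * (g j x - a j)).

Let mT k : measurable_fun [set: X] (iter k T).
Proof. by have [] := measure_preserving_iter k T_mu. Qed.

Lemma measurable_comp_iter k i :
  measurable_fun [set: X] (fun x => f k (iter i T x)).
Proof. exact: (measurableT_comp (mf k) (mT i)). Qed.

Let ge k x : `|g k x| <= 1.
Proof. by have /andP[g0 g1] := f01 k (iter k T x); rewrite ger0_norm. Qed.

Let ig k : mu.-integrable [set: X] (EFin \o g k).
Proof. exact: (bounded_integrable _ (measurable_comp_iter k k) (ge k)). Qed.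

Lemma Rintegral_comp_iter k : \int[mu]_x f k (iter k T x) = \int[mu]_x f k x.
Proof.
apply: (@Rintegral_measure_preserving _ _ _ mu (iter k T) (f k) 1) => //.
  exact: measure_preserving_iter.
by move=> x; have /andP[g0 g1] := f01 k x; rewrite ger0_norm.
Qed.

Let a_ge0 k : 0 <= a k.
Proof. by apply: Rintegral_ge0 => x _; have /andP[] := f01 k x. Qed.

Let igg i j : mu.-integrable [set: X] (EFin \o (fun x => g i x * g j x)).
Proof.
apply: (@bounded_integrable _ _ _ _ _ 1).
  by apply: measurable_funM; exact: measurable_comp_iter.
by move=> x; rewrite normrM mulr_ile1// ge.
Qed.

Let cE i j : c i j = \int[mu]_x (g i x * g j x) - a i * a j.
Proof.
rewrite /c (@eq_Rintegral _ _ _ _ _ (fun x =>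
  (g i x * g j x - a i * g j x) - (a j * g i x - a i * a j))); last first.
  by move=> x _; ring.
have iag b k : mu.-integrable [set: X] (EFin \o (fun x => b * g k x)).
  rewrite (_ : _ \o _ = (fun x => b%:E * (g k x)%:E)%E).
    exact: (integrableZl measurableT _ (ig k)).
  by apply/funext => x /=; rewrite EFinM.
have ic : mu.-integrable [set: X] (EFin \o (fun=> a i * a j)).
  exact: finite_measure_integrable_cst.
rewrite RintegralB//; last 2 first.
- exact: (integrableB measurableT (igg i j) (iag (a i) j)).
- exact: (integrableB measurableT (iag (a j) i) ic).
rewrite !RintegralB// Rintegral_cst_probability !RintegralZl//.
by rewrite /g !Rintegral_comp_iter -/(a i) -/(a j); ring.
Qed.

Let csym i j : c i j = c j i.
Proof. by rewrite /c; apply: eq_Rintegral => x _; rewrite mulrC. Qed.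

(** The product of means is nonnegative and [g i <= 1]. *)
Let c_le_mean i j : c i j <= a j.
Proof.
rewrite cE lerBlDr (le_trans _ (_ : a j <= _))//; last first.
  by rewrite lerDl mulr_ge0.
rewrite /a -Rintegral_comp_iter; apply: le_Rintegral => //.
  exact: ig.
move=> x _; have /andP[? ?] := f01 i (iter i T x).
by rewrite -[leRHS]mul1r ler_wpM2r//; have /andP[] := f01 j (iter j T x).
Qed.

(** Invariance under the [i]-th iterate moves the times [i] and [j] to 0 and [j - i], where decay of
    correlations applies. *)
Let c_le_decay i j : (1 <= i)%N -> (i < j)%N ->
  c i j <= l i * l j * Phi (j - i).
Proof.
move=> i1 ij; rewrite cE [a i * _]mulrC [l i * _]mulrC.
rewrite (_ : \int[mu]_x _ = \int[mu]_x (f j (iter (j - i) T x) * f i x)).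
  apply: decay_of_correlations_le => //; rewrite ?fl ?subn_gt0//.
  by rewrite (leq_trans i1)// ltnW.
rewrite -(@Rintegral_measure_preserving _ _ _ mu (iter i T)
    (fun x => f j (iter (j - i) T x) * f i x) 1).
- by apply: eq_Rintegral => x _; rewrite mulrC -iterD subnK// ltnW.
- exact: measure_preserving_iter.
- by apply: measurable_funM => //; exact: measurable_comp_iter.
- move=> x; rewrite normrM.
  have /andP[? ?] := f01 i x; have /andP[? ?] := f01 j (iter (j - i) T x).
  by rewrite mulr_ile1// ger0_norm.
Qed.

(** The variance is the double sum of covariances; [c_le_mean] serves gaps up to [t], [c_le_decay]
    the larger ones. *)
Lemma variance_le (N t : nat) (D : R) : 0 <= D ->
  (forall i j, (1 <= i)%N -> (i < j <= N)%N -> (t < j - i)%N ->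
    l i * l j * Phi (j - i) <= D / (j - i)%:R ^+ 2) ->
  \int[mu]_x (\sum_(1 <= k < N.+1) f k (iter k T x) -
              \sum_(1 <= k < N.+1) \int[mu]_x f k x) ^+ 2 <=
  (2 * t%:R + 1) * \sum_(1 <= k < N.+1) \int[mu]_x f k x + 4 * D * N%:R.
Proof.
move=> D0 far.
have -> : \int[mu]_x (\sum_(1 <= k < N.+1) f k (iter k T x) -
              \sum_(1 <= k < N.+1) \int[mu]_x f k x) ^+ 2 =
    \sum_(1 <= i < N.+1) \sum_(1 <= j < N.+1) c i j.
  under eq_Rintegral do rewrite -sumrB expr2 big_distrlr/=.
  have ih i j : mu.-integrable [set: X] (EFin \o
      (fun x => (g i x - a i) * (g j x - a j))).
    apply: (@bounded_integrable _ _ _ _ _ ((1 + a i) * (1 + a j))).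
      by apply: measurable_funM; apply: measurable_funB => //;
        exact: measurable_comp_iter.
    by move=> x; rewrite normrM ler_pM// (le_trans (ler_normB _ _))//
      lerD// ger0_norm.
  rewrite Rintegral_sum; last first.
    move=> i.
    rewrite (_ : _ \o _ = (fun x => \sum_(1 <= j < N.+1)
        ((g i x - a i) * (g j x - a j))%R%:E)%E).
      by apply: integrable_sum => // j _; exact: ih.
    by apply/funext => x /=; rewrite -sumEFin.
  by apply: eq_bigr => i _; apply: Rintegral_sum => j; exact: ih.
apply: sum_near_diagonal => // i j i1 /andP[ij jN].
case: (leqP (j - i) t) => jit.
  by rewrite ler_wpDr// divr_ge0// exprn_ge0.
have ij' : (i < j)%N by rewrite -subn_gt0 (leq_ltn_trans _ jit).
by rewrite add0r (le_trans (c_le_decay i1 ij'))// far// ij' jN.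
Qed.

End correlations.

(** * Almost everywhere limits for Lipschitz observables *)

(** The family [f] is abstract so that ramps outside and inside the balls are treated alike; [M]
    stands for the mass of the balls. *)
Lemma ae_cvg_lipschitz_observables (d : measure_display) (R : realType)
    (X : measurableMetricType d R) (x0 : X) (mu : probability X R) (T : X -> X)
    (Phi : nat -> R) (f : nat -> X -> R) (M : nat -> R)
    (alpha b c eps K A : R) :
  let m := fun n => \sum_(1 <= k < n.+1) \int[mu]_x f k x in
  measure_preserving mu T -> decay_of_correlations mu T Phi ->
  (forall n, 0 <= Phi n) ->
  (forall k, measurable_fun [set: X] (f k)) ->
  (forall k x, 0 <= f k x <= 1) -> 0 <= K -> 0 <= A ->
  (forall k, (1 <= k)%N ->
    (lipschitz_norm (f k) <= (K * k%:R `^ (- c + eps / 2))%:E)%E) ->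
  0 < alpha -> 2 * alpha < b -> b <= 1 -> c <= -1 -> 0 <= eps ->
  (\forall n \near \oo, n%:R `^ b < M n) ->
  (forall n, `|m n - M n| <= 2) ->
  (forall n, (1 <= n)%N -> M n <= 2 * n%:R) ->
  (forall N n, (1 <= N <= n)%N -> N%:R * M n <= 2 * n%:R * M N) ->
  (forall n, (1 <= n)%N -> n%:R `^ (2 - 2 * c + eps) *
     (Phi (Num.truncn (n%:R `^ alpha : R)) / M n ^+ 2) <= A) ->
  {ae mu, forall x,
    (\sum_(1 <= k < n.+1) f k (iter k T x)) / m n @[n --> \oo] --> (1 : R)}.
Proof.
move=> m T_mu T_decay Phi0 mf f01 K0 A0 fl a0 ab b1 c1 e0.
move=> [n0 _ Mb] mM M2n Mavg hA.
have b0 : 0 < b by lra.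
have mE n : m n = \sum_(1 <= k < n.+1) \int[mu]_x f k (iter k T x).
  by apply: eq_bigr => k _; rewrite Rintegral_comp_iter.
have moo : m n @[n --> \oo] --> +oo.
  apply/cvgryPge => B; near=> n.
  have n0n : (n0 <= n)%N by near: n; exact: nbhs_infty_ge.
  have := Mb n n0n; have := mM n; rewrite /= ler_distl => /andP[+ _].
  have : B + 2 <= n%:R `^ b.
    near: n; move/cvgryPge : (cvgry_powR_nat b0); exact.
  by lra.
(* From [N ^ b < M N] follows [N ^ (2 * alpha) <= M N ^ (2 * alpha / b)]; the other factor [M N]
   adds 1 to the exponent. *)
pose s := 1 + 2 * alpha / b.
(* The near pairs cost at most [3 * P * m N], covered by the 9. The far ones give [96 = 4 * 8 * 3],
   and both this 3 and the base 3 come from [M N <= 3 * m N]. *)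
pose C := (9 + 96 * (A * K ^+ 2)) * 3 `^ (2 * alpha / b).
have AK0 : 0 <= A * K ^+ 2 by rewrite mulr_ge0// sqr_ge0.
have ab1 : 2 * alpha / b < 1 by rewrite ltr_pdivrMr// mul1r.
have key : \forall n \near \oo, \int[mu]_x
    (\sum_(1 <= k < n.+1) f k (iter k T x) - m n) ^+ 2 <= C * m n `^ s.
  near=> N.
  have N0 : (n0 <= N)%N by near: N; exact: nbhs_infty_ge.
  have N1 : (1 <= N)%N by near: N; exact: nbhs_infty_ge.
  have m1 : 1 <= m N by near: N; move/cvgryPge : moo; exact.
  have m0 : 0 < m N by exact: lt_le_trans m1.
  have NR1 : 1 <= N%:R :> R by rewrite ler1n.
  have NR0 : 0 < N%:R :> R by rewrite ltr0n.
  have MN := Mb N N0.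
  have MN0 : 0 < M N by rewrite (le_lt_trans _ MN)// powR_ge0.
  have := mM N; rewrite ler_distl => /andP[Mm1 Mm2].
  have M3m : M N <= 3 * m N by lra.
  set P := N%:R `^ (2 * alpha) : R.
  have P1 : 1 <= P by rewrite -(powRr0 N%:R) ler_powR//; lra.
  pose D := K ^+ 2 * (4 * A * M N ^+ 2 * N%:R `^ (2 * alpha - 2)).
  have D0 : 0 <= D by rewrite !mulr_ge0 ?powR_ge0 ?(ltW MN0).
  (* A gap larger than [t] exceeds [N ^ alpha], as the decay bound requires. *)
  pose t := Num.truncn (N%:R `^ alpha : R).
  have tP : t%:R <= P.
    apply: (@le_trans _ _ (N%:R `^ alpha)).
      by have /andP[] := truncn_itv (powR_ge0 (N%:R : R) alpha).
    by rewrite ler_powR//; lra.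
  have := @variance_le _ _ _ x0 mu T Phi f
    (fun k => K * k%:R `^ (- c + eps / 2))
    T_mu T_decay Phi0 mf f01 fl N t D D0.
  move=> /(_ _)/le_trans; apply.
    move=> i j i1 /andP[ij jN] tij.
    have Nij : N%:R `^ alpha < (j - i)%:R :> R.
      by apply: lt_le_trans (truncnS_gt _) _; rewrite ler_nat.
    have := @decay_rate_of_summand_bound _ Phi M alpha eps c A N (j - i)
      a0 _ c1 e0 A0 Phi0 hA _ _ N1 Nij.
    move=> /(_ _ _ _); rewrite /D => dr.
    have g0 : 0 <= - c + eps / 2 by lra.
    have up k : (k <= N)%N ->
        k%:R `^ (- c + eps / 2) <= N%:R `^ (- c + eps / 2) :> R.
      by move=> kN; apply: (ge0_ler_powR g0); rewrite ?nnegrE ?ler0n// ler_nat.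
    have NN : (N%:R : R) `^ (- 2 * c + eps) =
        N%:R `^ (- c + eps / 2) * N%:R `^ (- c + eps / 2).
      rewrite -powRD ?(gt_eqF NR0) ?implybT//; congr (_ `^ _); lra.
    apply: (@le_trans _ _ (K ^+ 2 * (Phi (j - i)%N * N%:R `^ (- 2 * c + eps)))).
      have -> : K * i%:R `^ (- c + eps / 2) * (K * j%:R `^ (- c + eps / 2)) *
        Phi (j - i)%N = K ^+ 2 * (Phi (j - i)%N * (i%:R `^ (- c + eps / 2) *
          j%:R `^ (- c + eps / 2))) by ring.
      rewrite NN !ler_wpM2l ?sqr_ge0// ler_pM ?powR_ge0// up//.
      by rewrite (leq_trans (ltnW ij)).
    rewrite -mulrA; apply: (ler_wpM2l (sqr_ge0 K)); apply: dr.
    - by lra.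
    - move=> n Nn; apply: le_lt_trans (Mb n (leq_trans N0 Nn)); exact: powR_ge0.
    - by move=> n Nn; apply: Mavg; rewrite N1.
  have PE : N%:R `^ (2 * alpha - 2) * N%:R ^+ 2 = P.
    by rewrite -powR_mulrn ?ler0n// -powRD ?(gt_eqF NR0) ?implybT// subrK.
  (* [D] contains [M N ^ 2]; one factor is absorbed through [M N / N <= 2]. *)
  have DN : D * N%:R <= 8 * (A * K ^+ 2) * (3 * m N) * P.
    have -> : D * N%:R = 4 * (A * K ^+ 2) * (M N / N%:R) * M N *
        (N%:R `^ (2 * alpha - 2) * N%:R ^+ 2).
      by rewrite /D; field; rewrite gt_eqF.
    rewrite PE ler_wpM2r ?(le_trans ler01)//.
    have MN2 : M N / N%:R <= 2 by rewrite ler_pdivrMr// M2n.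
    apply: ler_pM => //; rewrite ?mulr_ge0 ?invr_ge0 ?(ltW MN0)//.
    rewrite (_ : 8 * _ = 4 * (A * K ^+ 2) * 2); last by ring.
    by rewrite ler_wpM2l// mulr_ge0.
  have P3 : P <= 3 `^ (2 * alpha / b) * m N `^ (2 * alpha / b).
    rewrite -powRM ?ler0n ?(ltW m0)//.
    have -> : P = (N%:R `^ b) `^ (2 * alpha / b).
      by rewrite /P -powRrM; congr (_ `^ _); field; rewrite gt_eqF.
    have q0 : 0 <= 2 * alpha / b by rewrite divr_ge0 ?mulr_ge0// ltW.
    apply: (ge0_ler_powR q0); rewrite ?nnegrE ?powR_ge0//; first by lra.
    exact: le_trans (ltW MN) M3m.
  have ms : m N `^ s = m N * m N `^ (2 * alpha / b).
    by rewrite /s powRD ?powRr1 ?(ltW m0) ?(gt_eqF m0) ?implybT.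
  rewrite -/(m N) ms.
  apply: (@le_trans _ _ ((9 + 96 * (A * K ^+ 2)) * (m N * P))); last first.
    have -> : C * (m N * m N `^ (2 * alpha / b)) = (9 + 96 * (A * K ^+ 2)) *
      (m N * (3 `^ (2 * alpha / b) * m N `^ (2 * alpha / b))) by rewrite /C; ring.
    by apply: ler_wpM2l; [rewrite addr_ge0 ?mulr_ge0|rewrite ler_wpM2l// ltW].
  have tm : t%:R * m N <= P * m N by rewrite ler_wpM2r// ltW.
  have mP : m N <= P * m N by rewrite ler_peMl// ltW.
  clear - DN tm mP AK0 m0.
  have -> : (9 + 96 * (A * K ^+ 2)) * (m N * P) =
    9 * (P * m N) + 96 * (A * K ^+ 2 * (P * m N)) by ring.
  have -> : (2 * t%:R + 1) * m N + 4 * D * N%:R =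
    2 * (t%:R * m N) + m N + 4 * (D * N%:R) by ring.
  have {DN} : D * N%:R <= 24 * (A * K ^+ 2 * (P * m N)).
    by apply: le_trans DN _; rewrite le_eqVlt; apply/orP; left; apply/eqP; ring.
  have : 0 <= A * K ^+ 2 * (P * m N).
    by rewrite mulr_ge0// (le_trans _ mP)// ltW.
  by lra.
have f01' k x : 0 <= f k (iter k T x) <= 1 by exact: f01.
have mfT k : measurable_fun [set: X] (fun x => f k (iter k T x)).
  exact: (measurable_comp_iter T_mu mf).
have C0 : 0 <= C by rewrite mulr_ge0 ?powR_ge0//; lra.
have s2 : s < 2 by rewrite /s; lra.
have mEf : m = fun n => \sum_(1 <= k < n.+1) \int[mu]_x f k (iter k T x).
  by apply/funext.
rewrite mEf in moo key *.
exact: (@ae_cvg_of_variance _ _ _ mu (fun k x => f k (iter k T x)) C s).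
Unshelve. all: by end_near. Qed.

(** * Constraints on the exponents, and uniform constants *)

Lemma powR_nat_le_linear_exponent (R : realType) (b K : R) :
  (\forall n \near \oo, n%:R `^ b <= K * n%:R) -> b <= 1.
Proof.
move=> H; rewrite leNgt; apply/negP => b1.
have b10 : 0 < b - 1 by rewrite subr_gt0.
near \oo => n.
have n1 : (1 <= n)%N by near: n; exact: nbhs_infty_ge.
have nR0 : 0 < n%:R :> R by rewrite ltr0n.
have : n%:R `^ b <= K * n%:R by near: n; exact: H.
have -> : n%:R `^ b = n%:R `^ (b - 1) * n%:R.
  by rewrite -[X in _ * X]powRr1 ?ler0n// -powRD ?(gt_eqF nR0) ?implybT// subrK.
rewrite ler_pM2r//; apply/negP; rewrite -ltNge.
by near: n; move/cvgryPgt : (cvgry_powR_nat b10); exact.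
Unshelve. all: by end_near. Qed.

(** For [b >= -1] the decrements dominate the harmonic series: each doubling of the index lowers [r]
    by at least [1 / 2], which positivity forbids. *)
Lemma decrement_exponent_le (R : realType) (r : nat -> R) (b : R) :
  (forall n, 0 < r n) ->
  (\forall n \near \oo, n%:R `^ b <= r n.-1 - r n) -> b < -1.
Proof.
move=> r0 [n0 _ H]; rewrite ltNge; apply/negP => b1.
have step n : (n0 <= n)%N -> (0 < n)%N -> r (n + n)%N <= r n - 2^-1.
  move=> n0n npos; have nR0 : 0 < n%:R :> R by rewrite ltr0n.
  (* Each of the [n] decrements between the times [n] and [2 n] is at least
     [1 / (2 n)]. *)
  suff h k : (k <= n)%N -> r (n + k)%N <= r n - k%:R / (2 * n%:R).
    apply: (le_trans (h n (leqnn n))); rewrite le_eqVlt; apply/orP; left.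
    by apply/eqP; field; rewrite gt_eqF.
  elim: k => [|k ih] kn; first by rewrite addn0 mul0r subr0.
  have := H (n + k.+1)%N (leq_trans n0n (leq_addr _ _)).
  rewrite /= addnS/= => h; have := ih (ltnW kn).
  have : (2 * n%:R)^-1 <= (n + k).+1%:R `^ b.
    apply: (@le_trans _ _ ((n + k).+1%:R `^ (-1))).
      rewrite powR_inv1 ?ler0n// lef_pV2 ?posrE ?mulr_gt0 ?ltr0n//.
      by rewrite -natrM ler_nat mul2n -addnn -addnS leq_add2l.
    by rewrite ler_powR// ler1n.
  by rewrite -(natr1 k) mulrDl mul1r; lra.
pose n1 := maxn n0 1.
have iter_step k : r (n1 * 2 ^ k)%N <= r n1 - k%:R / 2.
  elim: k => [|k ih]; first by rewrite muln1 mul0r subr0.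
  rewrite expnS mulnCA mul2n -addnn.
  have n1k : (n1 <= n1 * 2 ^ k)%N by rewrite leq_pmulr// expn_gt0.
  have := step (n1 * 2 ^ k)%N (leq_trans (leq_maxl _ _) n1k)
    (leq_trans (leq_maxr _ _) n1k).
  by rewrite -(natr1 k) mulrDl mul1r; lra.
(* More than [2 * r n1] doublings make the radius negative. *)
have := iter_step (Num.truncn (2 * r n1)).+1.
have := r0 (n1 * 2 ^ (Num.truncn (2 * r n1)).+1)%N.
by have := truncnS_gt (2 * r n1); lra.
Qed.

(** The finitely many exceptional values of [u] are summed into [K], which suffices because
    [v k >= 1]. *)
Lemma near_le_scale (R : realFieldType) (u v : nat -> R) :
  (forall k, 0 <= u k) -> (forall k, (1 <= k)%N -> 1 <= v k) ->
  (\forall k \near \oo, u k <= v k) ->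
  exists2 K, 0 <= K & forall k, (1 <= k)%N -> u k <= K * v k.
Proof.
move=> u0 v1 [n0 _ H]; exists (1 + \sum_(0 <= k < n0) u k).
  by rewrite addr_ge0// sumr_ge0.
move=> k k1; have vk := v1 k k1; have v0 : 0 <= v k by rewrite (le_trans _ vk).
have s0 : 0 <= \sum_(0 <= k < n0) u k by rewrite sumr_ge0.
case: (leqP n0 k) => kn.
  rewrite (le_trans (H k kn))// ler_peMl// lerDl//.
rewrite (@le_trans _ _ (1 + \sum_(0 <= k < n0) u k))//; last first.
  by rewrite ler_peMr// addr_ge0.
rewrite (bigD1_seq k) ?mem_index_iota ?iota_uniq//= addrCA lerDl.
by rewrite addr_ge0// sumr_ge0.
Qed.

Lemma cvg_ratio_bounded_gap (R : realType) (m D : nat -> R) (B : R) :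
  D n @[n --> \oo] --> +oo -> (forall n, `|m n - D n| <= B) ->
  m n / D n @[n --> \oo] --> (1 : R).
Proof.
move=> Doo mD; apply/cvgrPdist_le => e e0; near=> n.
have D0 : 0 < D n by near: n; move/cvgryPgt : Doo; exact.
have DB : B / e <= D n by near: n; move/cvgryPge : Doo; exact.
have -> : 1 - m n / D n = - ((m n - D n) / D n).
  by rewrite mulrBl divff ?opprB// gt_eqF.
rewrite normrN normrM normfV (gtr0_norm D0) ler_pdivrMr//.
by rewrite (le_trans (mD n))// mulrC -ler_pdivrMr.
Unshelve. all: by end_near. Qed.

(** * Masses of balls and means of ramps *)

Section ball_mass.
Context (d : measure_display) (R : realType) (X : measurableMetricType d R).
Context (X_borel : borel X) (mu : probability X R) (x0 : X) (r : nat -> R).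
Context (r_decr : decreasing_seq r).

Let b i := fine (mu (ball x0 (r i))).

Lemma ball_measure_ge0 i : 0 <= b i.
Proof. exact: fine_ge0. Qed.

Let mball i : measurable (ball x0 (r i)).
Proof. exact: measurable_metric_ball. Qed.

Let bE i : mu (ball x0 (r i)) = (b i)%:E.
Proof. by rewrite fineK// fin_num_measure. Qed.

Lemma ball_measure_le1 i : b i <= 1.
Proof. by rewrite -lee_fin -bE probability_le1. Qed.

Lemma ball_measure_nonincr i j : (i <= j)%N -> b j <= b i.
Proof.
move=> ij; rewrite -lee_fin -!bE le_measure ?inE// !ballEmdist => x /= xj.
by rewrite (lt_le_trans xj)// r_decr.
Qed.

Lemma ball_massS n :
  ball_mass mu x0 r n = b 0 + \sum_(1 <= k < n.+1) b k.
Proof. by rewrite /ball_mass big_nat_recl// big_add1. Qed.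

Lemma ball_mass_le n : ball_mass mu x0 r n <= n.+1%:R.
Proof.
rewrite /ball_mass (@le_trans _ _ (\sum_(0 <= k < n.+1) 1))//.
  by apply: ler_sum => k _; exact: ball_measure_le1.
by rewrite sumr_const_nat subn0.
Qed.

(** Monotone averages, with [n.+1 <= 2 * n] to remove the successors. *)
Lemma ball_mass_average N n : (1 <= N <= n)%N ->
  N%:R * ball_mass mu x0 r n <= 2 * n%:R * ball_mass mu x0 r N.
Proof.
move=> /andP[N1 Nn].
have M0 k : 0 <= ball_mass mu x0 r k.
  by apply: sumr_ge0 => i _; exact: ball_measure_ge0.
apply: (@le_trans _ _ (N.+1%:R * ball_mass mu x0 r n)).
  by rewrite ler_wpM2r// ler_nat.
apply: (le_trans (sum_average_le ball_measure_nonincr Nn)).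
rewrite ler_wpM2r//; first exact: M0.
by rewrite -natrM ler_nat mul2n -addnn -addn1 leq_add2l (leq_trans N1).
Qed.

Lemma Rintegral_ramp_bounds a a' : a < a' ->
  fine (mu (ball x0 a)) <= \int[mu]_x ramp x0 a a' x <= fine (mu (ball x0 a')).
Proof.
move=> aa'.
have ii e : mu.-integrable [set: X] (EFin \o (\1_(ball x0 e) : X -> R)).
  by apply: integrable_indic; exact: measurable_metric_ball.
have ir : mu.-integrable [set: X] (EFin \o (ramp x0 a a' : X -> R)).
  apply: (@bounded_integrable _ _ _ _ _ 1); first exact: measurable_ramp.
  by move=> x; rewrite ger0_norm ?ramp_le1// ramp_ge0.
have iE e : \int[mu]_x (\1_(ball x0 e) x : R) = fine (mu (ball x0 e)).
  rewrite /Rintegral integral_indic ?setIT//; exact: measurable_metric_ball.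
rewrite -!iE; apply/andP; split; apply: le_Rintegral => // x _.
  exact: indic_le_ramp.
exact: ramp_le_indic.
Qed.

End ball_mass.

(** * From ramps to balls *)

Theorem corollary9 (d : measure_display) (R : realType)
    (X : measurableMetricType d R)
    (X_separable : separable X) (X_borel : borel X)
    (mu : probability X R)
    (T : X -> X) (T_mu : measure_preserving mu T)
    (Phi : nat -> R) (Phi_ge0 : forall n, 0 <= Phi n)
    (T_decay : decay_of_correlations mu T Phi)
    (x0 : X) (r : nat -> R)
    (r_gt0 : forall i, 0 < r i) (r_decr : decreasing_seq r)
    (z : R) (z_gt0 : 0 < z)
    (h_i : limn_einf (fun k : nat =>
       (ln (ball_mass mu x0 r k) / ln k%:R)%:E) = z%:E)
    (c : R)
    (h_ii : limn_einf (fun n : nat =>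
       (ln (r n.-1 - r n) / ln n%:R)%:E) = c%:E)
    (alpha : R) (alpha_gt0 : 0 < alpha) (alpha_lt : alpha < z / 2)
    (eps : R) (eps_gt0 : 0 < eps)
    (h_iii : (\sum_(1 <= n <oo)
       (n%:R `^ (2 - 2 * c + eps) *
        (Phi (Num.truncn (n%:R `^ alpha : R)) / ball_mass mu x0 r n ^+ 2))%:E
       < +oo)%E) :
  strongly_borel_cantelli mu T (fun i => ball x0 (r i)).
Proof.
pose M := ball_mass mu x0 r; pose b i := fine (mu (ball x0 (r i))).
have b0 i : 0 <= b i by exact: ball_measure_ge0.
have b1 i : b i <= 1 by exact: ball_measure_le1.
have r_lt i : r i.+1 < r i by rewrite ltNge r_decr ltnn.
have ME n : M n = b 0%N + \sum_(1 <= k < n.+1) b k by exact: ball_massS.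
have M0 n : 0 <= M n by apply: sumr_ge0 => i _; exact: b0.
have M_le n : (1 <= n)%N -> M n <= 2 * n%:R.
  move=> n1; apply: (le_trans (ball_mass_le X_borel mu x0 r n)).
  by rewrite -natrM ler_nat mul2n -addnn -addn1 leq_add2l.
(* The midpoint, strictly between [2 * alpha] and [z]. *)
pose beta := (2 * alpha + z) / 2.
have beta0 : 0 < beta by rewrite /beta; lra.
have Mbeta : \forall n \near \oo, n%:R `^ beta < M n.
  have bz : beta < z by rewrite /beta; lra.
  near=> n.
  have Mn0 : 0 < M n.
    (* A zero mass would make the ratio in (i) equal to 0, by the default value of [ln], while that
       ratio is eventually positive. *)
    rewrite lt0r M0 andbT; apply/eqP => Mn0.
    suff : 0 < ln (M n) / ln n%:R by rewrite Mn0 ln0// mul0r ltxx.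
    by near: n; exact: limn_einf_gt_near h_i z_gt0.
  by move: Mn0; near: n; exact: ratio_ln_gt_near h_i bz.
have beta1 : beta <= 1.
  apply: (@powR_nat_le_linear_exponent _ _ 2); near=> n.
  apply: (@le_trans _ _ (M n)).
    by apply: ltW; near: n.
  by apply: M_le; near: n; exact: nbhs_infty_ge.
have decr e : e < c -> \forall n \near \oo, n%:R `^ e < r n.-1 - r n.
  move=> ec; have [n0 _ H] := ratio_ln_gt_near h_ii ec.
  (* Starting at [n0.+1] discards [n = 0], where [n.-1 = n] and the decrement is 0. *)
  exists n0.+1 => // -[//|n] /= n0n; apply: H; first exact: ltnW.
  by rewrite /= subr_gt0.
have c1 : c <= -1.
  rewrite leNgt; apply/negP => c1.
  (* If [c > -1], the midpoint of [c] and [-1] is an admissible exponent still above [-1]. *)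
  have : (c - 1) / 2 < -1; last by lra.
  apply: (decrement_exponent_le r_gt0).
  have : (c - 1) / 2 < c by lra.
  by move=> /decr; apply: filterS => n /ltW.
pose gam := - c + eps / 2.
have gam0 : 0 <= gam by rewrite /gam; lra.
have pow1 k : (1 <= k)%N -> 1 <= k%:R `^ gam :> R.
  by move=> k1; rewrite -[leLHS](powRr0 k%:R) ler_powR// ler1n.
(* The left side bounds the norm of a ramp. By (ii) with the exponent [c - eps / 2], the inverse
   decrement is eventually at most [k ^ gam], and so is 1. *)
have [K K0 HK] : exists2 K, 0 <= K & forall k, (1 <= k)%N ->
    1 + (r k.-1 - r k)^-1 <= K * (2 * k%:R `^ gam).
  apply: near_le_scale.
  - case=> [|k]; first by rewrite subrr invr0 addr0.
    by rewrite addr_ge0// invr_ge0 subr_ge0 ltW.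
  - by move=> k /pow1; lra.
  - have : c - eps / 2 < c by lra.
    move=> /decr [n0 _ H]; exists (maxn n0 1) => // k /=.
    rewrite geq_max => /andP[n0k k1].
    have kR : 0 < k%:R :> R by rewrite ltr0n.
    have := H k n0k; rewrite /= => /ltW; have := pow1 k k1.
    have : 0 < k%:R `^ (c - eps / 2) :> R by rewrite powR_gt0.
    rewrite (_ : c - eps / 2 = - gam); last by rewrite /gam; ring.
    move=> p0 p1 h; rewrite mulrDl !mul1r lerD//.
    rewrite -[gam]opprK powRN lef_pV2 ?posrE ?powR_gt0//.
    exact: lt_le_trans h.
have [A A0 HA] : exists2 A, 0 <= A & forall n, (1 <= n)%N ->
    n%:R `^ (2 - 2 * c + eps) *
     (Phi (Num.truncn (n%:R `^ alpha : R)) / M n ^+ 2) <= A.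
  pose u n : R := n%:R `^ (2 - 2 * c + eps) *
     (Phi (Num.truncn (n%:R `^ alpha : R)) / M n ^+ 2).
  have u0 n : 0 <= u n by rewrite mulr_ge0 ?powR_ge0// divr_ge0// sqr_ge0.
  have S0 : (0 <= \sum_(1 <= n <oo) (u n)%:E)%E.
    by apply: nneseries_ge0 => n _ _; rewrite lee_fin.
  (* The sum of the nonnegative series bounds each of its terms. *)
  exists (fine (\sum_(1 <= n <oo) (u n)%:E)%E); first exact: fine_ge0.
  move=> n n1; rewrite -/(u n) -lee_fin fineK ?ge0_fin_numE//.
  apply: (@le_trans _ _ (\sum_(1 <= k < n.+1) (u k)%:E)%E).
    rewrite big_nat_recr//= leeDr// sume_ge0// => k _; rewrite lee_fin.
    exact: u0.
  by apply: nneseries_lim_ge => k _ _; rewrite lee_fin.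
(* The indicator of the [k]-th ball lies between [flo k] and [fup k] for [k >= 1]; [flo k] is
   [fup k.+1]. *)
pose fup k : X -> R := ramp x0 (r k) (r k.-1).
pose flo k : X -> R := ramp x0 (r k.+1) (r k).
pose D n := \sum_(1 <= k < n.+1) b k.
have DM n : D n = M n - b 0%N by rewrite ME addrAC subrr add0r.
have up_mean n : `|\sum_(1 <= k < n.+1) \int[mu]_x fup k x - M n| <= 2.
  have lo : D n <= \sum_(1 <= k < n.+1) \int[mu]_x fup k x.
    apply: ler_sum_nat => -[//|k] _.
    by have /andP[] := Rintegral_ramp_bounds X_borel mu x0 (r_lt k).
  have hi : \sum_(1 <= k < n.+1) \int[mu]_x fup k x <= M n.
    apply: (@le_trans _ _ (\sum_(1 <= k < n.+1) b k.-1)).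
      apply: ler_sum_nat => -[//|k] _.
      by have /andP[] := Rintegral_ramp_bounds X_borel mu x0 (r_lt k).
    by rewrite big_add1/= /M /ball_mass [leRHS]big_nat_recr//= lerDl; exact: b0.
  rewrite ler_distl; rewrite DM in lo; apply/andP.
  by have := b0 0%N; have := b1 0%N; split; lra.
have lo_mean n : `|\sum_(1 <= k < n.+1) \int[mu]_x flo k x - M n| <= 2.
  have hi : \sum_(1 <= k < n.+1) \int[mu]_x flo k x <= D n.
    apply: ler_sum_nat => k _.
    by have /andP[] := Rintegral_ramp_bounds X_borel mu x0 (r_lt k).
  (* The inner ramps dominate the balls of index [k.+1], so only the masses of indices 0 and 1 are
     lost. *)
  have lo : M n <= b 0%N + b 1%N + \sum_(1 <= k < n.+1) \int[mu]_x flo k x.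
    apply: (@le_trans _ _ (b 0%N + b 1%N + \sum_(1 <= k < n.+1) b k.+1)).
      rewrite -addrA -(big_nat_recl n.+1 1 b)// -ME /M /ball_mass.
      by rewrite [leRHS]big_nat_recr//= lerDl; exact: b0.
    rewrite lerD2l; apply: ler_sum_nat => k _.
    by have /andP[] := Rintegral_ramp_bounds X_borel mu x0 (r_lt k).
  rewrite ler_distl; rewrite DM in hi; apply/andP.
  by have := b0 0%N; have := b1 0%N; have := b1 1%N; split; lra.
have Doo : D n @[n --> \oo] --> +oo.
  apply/cvgryPge => B; near=> n.
  rewrite DM lerBrDr; apply: (@le_trans _ _ (B + 1)); first by rewrite lerD2l.
  apply: (@le_trans _ _ (n%:R `^ beta)).
    by near: n; move/cvgryPge : (cvgry_powR_nat beta0); exact.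
  by apply: ltW; near: n.
have ae_cvg (f : nat -> X -> R) (L : R) :
  (forall k, measurable_fun [set: X] (f k)) ->
  (forall k x, 0 <= f k x <= 1) -> 0 <= L ->
  (forall k, (1 <= k)%N -> (lipschitz_norm (f k) <= (L * k%:R `^ gam)%:E)%E) ->
  (forall n, `|\sum_(1 <= k < n.+1) \int[mu]_x f k x - M n| <= 2) ->
  {ae mu, forall x,
    (\sum_(1 <= k < n.+1) f k (iter k T x)) / D n @[n --> \oo] --> (1 : R)}.
  move=> mf f01 L0 fL fM.
  have a2 : 2 * alpha < beta by rewrite /beta; lra.
  have := ae_cvg_lipschitz_observables x0 T_mu T_decay Phi_ge0 mf f01 L0 A0 fL
    alpha_gt0 a2 beta1 c1 (ltW eps_gt0) Mbeta fM M_le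
    (ball_mass_average X_borel mu x0 r_decr) HA.
  apply: filterS => x Sm.
  pose m n := \sum_(1 <= k < n.+1) \int[mu]_x f k x.
  have mD n : `|m n - D n| <= 3.
    have := fM n; rewrite -/(m n) DM !ler_distl => /andP[h1 h2]; apply/andP.
    by have := b0 0%N; have := b1 0%N; split; lra.
  have := cvgM Sm (cvg_ratio_bounded_gap Doo mD); rewrite mulr1.
  move=> /(_ eventually_filter); apply: cvg_trans; apply: near_eq_cvg; near=> n.
  (* With a gap of at most 3, this keeps [m n] positive, so that it cancels. *)
  have Dn : 4 <= D n by near: n; move/cvgryPge : Doo; exact.
  have := mD n; rewrite ler_distl => /andP[mn _].
  have m0 : 0 < m n by lra.
  by rewrite /= mulrA divfK// gt_eqF.
have ae_up : {ae mu, forall x,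
    (\sum_(1 <= k < n.+1) fup k (iter k T x)) / D n @[n --> \oo] --> (1 : R)}.
  apply: (ae_cvg fup (K * 2)) => //; rewrite ?mulr_ge0//.
  - by move=> k; exact: measurable_ramp.
  - by move=> k x; rewrite ramp_ge0 ramp_le1.
  - case=> // k _; apply: (le_trans (lipschitz_norm_ramp _ _)); first exact: r_lt.
    by rewrite lee_fin -mulrA HK.
have ae_lo : {ae mu, forall x,
    (\sum_(1 <= k < n.+1) flo k (iter k T x)) / D n @[n --> \oo] --> (1 : R)}.
  (* The norm bound is taken at [k.+1 <= 2 * k], whence the factor [2 ^ gam]. *)
  apply: (ae_cvg flo (K * 2 * 2 `^ gam)) => //; rewrite ?mulr_ge0 ?powR_ge0//.
  - by move=> k; exact: measurable_ramp.
  - by move=> k x; rewrite ramp_ge0 ramp_le1.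
  - move=> k k1; apply: (le_trans (lipschitz_norm_ramp _ _)); first exact: r_lt.
    rewrite lee_fin -!mulrA (le_trans (HK k.+1 _))// !ler_wpM2l//.
    rewrite -powRM//; apply: (ge0_ler_powR gam0); rewrite ?nnegrE ?mulr_ge0//.
    by rewrite -natrM ler_nat mul2n -addnn -addn1 leq_add2l.
split.
  apply/eqyP => B B0.
  have : \forall n \near \oo, B <= D n by move/cvgryPge : Doo; exact.
  move=> [n _ /(_ n (leqnn n))/= Bn].
  apply: (@le_trans _ _ (\sum_(1 <= k < n.+1) mu (ball x0 (r k)))%E); last first.
    exact: nneseries_lim_ge.
  rewrite (eq_bigr (fun k => (b k)%:E)) ?sumEFin ?lee_fin// => k _.
  by rewrite fineK// fin_num_measure//; exact: measurable_metric_ball.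
apply: filterS2 ae_up ae_lo => x up lo.
apply: squeeze_cvgr lo up; near=> n.
have D0 : 0 < D n by near: n; move/cvgryPgt : Doo; exact.
rewrite !ler_pM2r ?invr_gt0//; apply/andP; split; apply: ler_sum_nat => k /andP[k1 _].
  exact: ramp_le_indic.
by apply: indic_le_ramp; case: k k1.
Unshelve. all: by end_near. Qed.
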